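(* Let $p>2$ be a prime number, let $f(x)=x^4+ax^2+bx+c\in\mathbb{Z}[x]$ be irreducible, $\theta$ a root of $f(x)$ in an algebraic closure of $\mathbb{Q}$, and $K=\mathbb{Q}(\theta)$. Suppose that $f(x)$ has only one double root modulo $p$, that is, $f(x)\equiv (x-s_0)^2g(x)\pmod p$ for some integer $s_0$ and some polynomial $g(x)$ that is separable modulo $p$ and satisfies $p\nmid g(s_0)$. Put $\Delta=v_p(\operatorname{disc}(f))$, and let $s$ be an integer with $s\equiv s_0\pmod p$ and $v_p(f'(s))>\Delta/2$. Then $$1,\quad \theta,\quad \theta^2,\quad \frac{\theta^3+s\theta^2+(a+s^2)\theta+s^3+as+b}{p^{\nu}},\qquad \nu=\lfloor\Delta/2\rfloor,$$ is a $p$-integral basis of $K$.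
   Context: $v_p$ is the $p$-adic valuation, $v_p(0)=\infty$. A $p$-integral basis of $K$ is a family of elements of $K$ that is a $\mathbb{Z}_{(p)}$-basis of $\mathbb{Z}_K\otimes_{\mathbb{Z}}\mathbb{Z}_{(p)}$, where $\mathbb{Z}_K$ is the ring of integers of $K$ and $\mathbb{Z}_{(p)}$ the localization of $\mathbb{Z}$ at $p$. *)

(* Defs.v *)
From HB Require Import structures.
From mathcomp Require Import all_boot all_order all_algebra all_field.
From mathcomp Require Export constructive_ereal.

Set Implicit Arguments.
Unset Strict Implicit.
Unset Printing Implicit Defensive.

Import Order.TTheory GRing.Theory Num.Theory.
Local Open Scope ring_scope.

(* The p-adic valuation on the integers, with v_p(0) = +oo.  Values are taken
   in \bar rat so that halves of valuations can be compared with it. *)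
Definition vp (p : nat) (m : int) : \bar rat :=
  if m == 0 then +oo%E else ((logn p `|m|%N)%:R)%:E.

(* disc(f) = (-1)^(n(n-1)/2) Res(f, f') / lc(f) with n = deg f; the division is
   exact.  [resultant] lists coefficients in increasing degree, which changes
   the usual resultant by the factor (-1)^(n(n-1)) = 1. *)
Definition disc (f : {poly int}) : int :=
  (((-1) ^+ 'C((size f).-1, 2) * resultant f f^`()) %/ lead_coef f)%Z.

(* Q(theta): rational functions in theta with rational coefficients.  Since
   x / 0 = 0, a vanishing denominator only yields 0. *)
Definition Qadj (theta x : algC) : Prop :=
  exists q r : {poly rat},
    x = (map_poly ratr q).[theta] / (map_poly ratr r).[theta].

Definition ringOfIntegers (K : algC -> Prop) (x : algC) : Prop :=
  K x /\ x \in Aint.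

Definition Zloc (p : nat) (r : rat) : Prop := ~~ (p%:Z %| denq r)%Z.

(* The tensor product of Z_K with Z_(p), realised inside K as the localisation
   of Z_K at the integers prime to p. *)
Definition ZKloc (p : nat) (K : algC -> Prop) (x : algC) : Prop :=
  exists (y : algC) (m : int),
    [/\ ringOfIntegers K y, ~~ (p%:Z %| m)%Z & x = y / m%:~R].

Definition pIntegralBasis (p : nat) (K : algC -> Prop) (n : nat)
    (e : n.-tuple algC) : Prop :=
  [/\ forall i : 'I_n, ZKloc p K (tnth e i),
      forall x : algC, ZKloc p K x ->
        exists c : 'I_n -> rat,
          (forall i, Zloc p (c i)) /\ x = \sum_(i < n) ratr (c i) * tnth e i
    & forall c : 'I_n -> rat, (forall i, Zloc p (c i)) ->
        \sum_(i < n) ratr (c i) * tnth e i = 0 -> forall i, c i = 0].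

(* Main.v *)
Require Import Defs.
From HB Require Import structures.
From mathcomp Require Import all_boot all_order all_algebra all_field.
From mathcomp Require Import ring zify.

Set Implicit Arguments.
Unset Strict Implicit.
Unset Printing Implicit Defensive.

Import Order.TTheory GRing.Theory Num.Theory.
Local Open Scope ring_scope.

(** Expand f at s as y ^ 4 + B y ^ 3 + C y ^ 2 + D y + E, with D = f'(s) and
    E = f(s).  The discriminant has the form E U + D ^ 2 V
    ([quarticDisc_taylor]), and the shape of f modulo p makes U a unit at p
    ([discCofactor_double_root]).  Since p ^ Delta divides both disc(f) and
    D ^ 2, it divides E ([dvd_taylor_coef0]).

    The numerator of the fourth element is (f(x) - f(s)) / (x - s) at theta, that
    is, - E / (theta - s).  Reversing the equation of theta - s gives a monic
    equation for it, and the divisibility of D by p ^ nu and of E by p ^ (2 nu)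
    allows the division by p ^ nu ([Aint_generator]).

    The family thus consists of integers of K, and its discriminant is
    disc(f) / p ^ (2 nu), whose valuation is 0 or 1.  Cramer's rule for the
    conjugates of an integer of K shows that the square of each of its
    coordinates, multiplied by this discriminant, is an algebraic integer
    ([Aint_Cramer]) and rational, hence an integer; a valuation at most 1 leaves
    no room for p in a denominator ([Zloc_of_sqr], [pIntegralBasis_quartic]). *)

(** * The discriminant of a depressed quartic *)

(** Expansion along the first row, with [None] standing for a zero entry: on a
    sparse matrix given by explicit rows, only the nonvanishing terms survive
    simplification. *)
Fixpoint laplace (R : pzRingType) (n : nat) (F : nat -> nat -> option R) : R :=
  if n is m.+1 then
    foldr (fun j acc =>
      if F 0 j is Some x then
        (-1) ^+ j * (x * laplace m (fun i k => F i.+1 (bump j k))) + acc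
      else acc) 0 (iota 0 n)
  else 1.

Lemma det_laplace (R : comPzRingType) (n : nat) (F : nat -> nat -> option R) :
  \det (\matrix_(i < n, j < n) odflt 0 (F i j)) = laplace n F.
Proof.
elim: n F => [|n IHn] F; first by rewrite det_mx00.
rewrite (expand_det_row _ ord0) /laplace -/laplace.
transitivity (\sum_(0 <= j < n.+1) odflt 0 (F 0 j) *
   ((-1) ^+ j * laplace n (fun i k => F i.+1 (bump j k)))).
  rewrite big_mkord; apply: eq_bigr => j _; rewrite mxE; congr (_ * _).
  rewrite /cofactor add0n -IHn; congr (_ * \det _).
  by apply/matrixP=> i k; rewrite !mxE.
rewrite unlock /index_iota subn0; elim: (iota 0 n.+1) => //= j s ->.
by case: (F 0 j) => [x|] /=; rewrite ?mul0r ?add0r // mulrCA.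
Qed.

Definition quarticDisc (R : pzRingType) (a b c : R) : R :=
  16 * a ^+ 4 * c - 4 * a ^+ 3 * b ^+ 2 - 128 * a ^+ 2 * c ^+ 2
  + 144 * a * b ^+ 2 * c - 27 * b ^+ 4 + 256 * c ^+ 3.

Lemma polyseq_quartic (R : comNzRingType) (a b c : R) :
  'X^4 + a *: 'X^2 + b *: 'X + c%:P = [:: c; b; a; 0; 1] :> seq R.
Proof.
have -> : 'X^4 + a *: 'X^2 + b *: 'X + c%:P = Poly [:: c; b; a; 0; 1].
  by rewrite /= !cons_poly_def -!mul_polyC; ring.
by apply: (@PolyK _ 0); rewrite /= oner_neq0.
Qed.

Lemma map_quartic (R S : comNzRingType) (phi : {rmorphism R -> S}) (a b c : R) :
  map_poly phi ('X^4 + a *: 'X^2 + b *: 'X + c%:P)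
  = 'X^4 + phi a *: 'X^2 + phi b *: 'X + (phi c)%:P.
Proof.
by rewrite !rmorphD /= !map_polyZ !map_polyXn map_polyX map_polyC.
Qed.

Lemma horner_quartic (R : comNzRingType) (a b c t : R) :
  ('X^4 + a *: 'X^2 + b *: 'X + c%:P).[t]
  = t ^+ 4 + a * t ^+ 2 + b * t + c.
Proof. by rewrite !(hornerD, hornerZ, hornerXn, hornerX, hornerC). Qed.

(** With its rows listed explicitly, the sparse Sylvester matrix of size 7 has a
    determinant that [laplace] computes. *)
Lemma resultant_quartic (a b c : int) :
  let f : {poly int} := 'X^4 + a *: 'X^2 + b *: 'X + c%:P in
  resultant f f^`() = quarticDisc a b c.
Proof.
move=> f; have Ef : f = [:: c; b; a; 0; 1] :> seq int by exact: polyseq_quartic.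
have Ef' : f^`() = [:: b; a *+ 2; 0; 4] :> seq int.
  have -> : f^`() = Poly [:: b; a *+ 2; 0; 4].
    apply/polyP=> i; rewrite coef_deriv Ef coef_Poly.
    by case: i => [|[|[|[|[|i]]]]] //=; rewrite ?nth_nil ?mul0rn // mul0rn.
  exact: (@PolyK _ 0).
pose rows : seq (seq (option int)) :=
 [:: [:: Some c; Some b; Some a; None; Some 1];
     [:: None; Some c; Some b; Some a; None; Some 1];
     [:: None; None; Some c; Some b; Some a; None; Some 1];
     [:: Some b; Some (a *+ 2); None; Some 4];
     [:: None; Some b; Some (a *+ 2); None; Some 4];
     [:: None; None; Some b; Some (a *+ 2); None; Some 4];
     [:: None; None; None; Some b; Some (a *+ 2); None; Some 4]].
have -> : resultant f f^`() = \det (\matrix_(i < 7, j < 7)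
     odflt 0 (nth None (nth [::] rows i) j)).
  have := @Sylvester_mxE _ f f^`(); rewrite /resultant; move: (Sylvester_mx _ _).
  rewrite {}Ef {}Ef' /= => S ES; congr (\det _); apply/matrixP=> i j.
  rewrite mxE ES /=; case: splitP => k /= ->; case: k => [[|[|[|[|k]]]] //= _];
  by case: j => [[|[|[|[|[|[|[|j]]]]]]] ].
rewrite (@det_laplace _ 7 (fun i j => nth None (nth [::] rows i) j)) /laplace /=.
by rewrite /quarticDisc; ring.
Qed.

(** The product formula for the discriminant; the vanishing of the cubic
    coefficient eliminates the fourth root. *)
Lemma quartic_roots (F : closedFieldType) (a b c : F) :
  exists x y z w : F,
    all (root ('X^4 + a *: 'X^2 + b *: 'X + c%:P)) [:: x; y; z; w]
    /\ quarticDisc a b c = ((y - x) * (z - x) * (w - x) * (z - y)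
                            * (w - y) * (w - z)) ^+ 2.
Proof.
set f := _ + c%:P.
have Ef : f = [:: c; b; a; 0; 1] :> seq F by exact: polyseq_quartic.
have lead_f : lead_coef f = 1 by rewrite /lead_coef Ef.
have [r] := closed_field_poly_normal f; rewrite lead_f scale1r => Df.
have sz_r : size r = 4%N.
  by have := size_prod_XsubC r id; rewrite -Df Ef => -[].
case: r => [|x [|y [|z [|w [|]]]]] // in sz_r Df *.
exists x, y, z, w; split.
  by apply/allP=> t t_r; rewrite Df root_prod_XsubC.
have {}Df : f = Poly [:: x * y * z * w;
   - (x * y * z + x * y * w + x * z * w + y * z * w);
   x * y + x * z + x * w + y * z + y * w + z * w; - (x + y + z + w); 1].
  by rewrite Df unlock /= !cons_poly_def; ring.
have coef_f i : _`_i = _`_i := congr1 (coefp i) Df.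
move: (coef_f 0) (coef_f 1) (coef_f 2) (coef_f 3).
rewrite !coef_Poly !Ef /= => -> -> -> E3.
have -> : w = - (x + y + z) by rewrite -[LHS]addr0 E3; ring.
by rewrite /quarticDisc; ring.
Qed.

(** * The Taylor expansion at a double root modulo p *)

(** With y ^ 4 + B y ^ 3 + C y ^ 2 + D y + E in place of the quartic, this is the
    factor U in a decomposition disc = E U + D ^ 2 V: when E = 0 the polynomial
    is y times a cubic with constant term D, so its discriminant is a multiple
    of D ^ 2. *)
Definition discCofactor (R : pzRingType) (B C D E : R) : R :=
  256 * E ^+ 2 - 192 * B * D * E - 128 * C ^+ 2 * E + 144 * C * D ^+ 2
  + 144 * B ^+ 2 * C * E - 6 * B ^+ 2 * D ^+ 2 - 80 * B * C ^+ 2 * D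
  + 16 * C ^+ 4 - 27 * B ^+ 4 * E + 18 * B ^+ 3 * C * D
  - 4 * B ^+ 2 * C ^+ 3.

(** B, C, D, E are the lower Taylor coefficients of the quartic at s, and
    translation by s preserves the discriminant. *)
Lemma quarticDisc_taylor (R : comPzRingType) (a b c s : R) :
  let B := 4 * s in
  let C := 6 * s ^+ 2 + a in
  let D := 4 * s ^+ 3 + 2 * a * s + b in
  let E := s ^+ 4 + a * s ^+ 2 + b * s + c in
  quarticDisc a b c = E * discCofactor B C D E
    + D ^+ 2 * (B ^+ 2 * C ^+ 2 - 4 * C ^+ 3 - 4 * B ^+ 3 * D
                + 18 * B * C * D - 27 * D ^+ 2).
Proof. rewrite /quarticDisc /discCofactor /=; ring. Qed.

(** At a double root D = E = 0, and the cofactor reduces to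
    -4 C ^ 3 (B ^ 2 - 4 C); here C = g(s), and B ^ 2 - 4 C is the discriminant of
    the quadratic g. *)
Lemma discCofactor_double_root (F : fieldType) (a b c s : F) (g : {poly F}) :
    2 != 0 :> F -> 'X^4 + a *: 'X^2 + b *: 'X + c%:P = ('X - s%:P) ^+ 2 * g ->
    separable_poly g -> g.[s] != 0 ->
  discCofactor (4 * s) (6 * s ^+ 2 + a) (4 * s ^+ 3 + 2 * a * s + b)
    (s ^+ 4 + a * s ^+ 2 + b * s + c) != 0.
Proof.
move=> nz2 fg sep_g gs.
have sz_g : size g = 3%N.
  have nz_g : g != 0 by apply: separable_poly_neq0.
  have := congr1 (fun q : {poly F} => size q) fg.
  rewrite polyseq_quartic size_monicM ?monic_exp ?monicXsubC //.
  by rewrite size_exp_XsubC /= => -[].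
have Dg : g = (g`_0)%:P + g`_1 *: 'X + g`_2 *: 'X^2.
  by rewrite -[LHS]coefK sz_g poly_def !big_ord_recl big_ord0 /= expr0 expr1
    alg_polyC addr0 addrA.
move: (g`_0) (g`_1) (g`_2) => g0 g1 g2 in Dg.
have Dfg : ('X - s%:P) ^+ 2 * g = Poly [:: s ^+ 2 * g0;
   s ^+ 2 * g1 - 2 * s * g0; s ^+ 2 * g2 - 2 * s * g1 + g0;
   g1 - 2 * s * g2; g2].
  by rewrite Dg /= !cons_poly_def -!mul_polyC; ring.
have coef_fg i : _`_i = _`_i := congr1 (coefp i) (etrans fg Dfg).
move: (coef_fg 0) (coef_fg 1) (coef_fg 2) (coef_fg 3) (coef_fg 4).
rewrite !coef_Poly !polyseq_quartic /= => Ec Eb Ea E3 E4.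
subst g2; have Dg1 : g1 = 2 * s by rewrite -[g1]subr0 E3; ring.
have Dg0 : g0 = a + 3 * s ^+ 2 by rewrite Ea Dg1; ring.
have Dgs : g.[s] = 6 * s ^+ 2 + a.
  by rewrite Dg !(hornerD, hornerZ, hornerC, hornerX, hornerXn) Dg1 Dg0; ring.
have nz_disc : g1 ^+ 2 - 4 * g0 != 0.
  apply: contraL sep_g => /eqP disc0; rewrite unlock.
  (* A vanishing discriminant makes - g1 / 2 a common root of g and g'. *)
  have gr : root g (- g1 / 2).
    rewrite /root Dg !(hornerD, hornerZ, hornerC, hornerX, hornerXn); apply/eqP.
    transitivity (- (g1 ^+ 2 - 4 * g0) / 4); last by rewrite disc0 oppr0 mul0r.
    by field; rewrite -[4]/(2 * 2)%:R natrM mulf_neq0.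
  apply: contraTN gr => /coprimep_root co; apply/negP=> /co/eqP[].
  rewrite Dg !(derivD, derivZ, derivC, derivX, derivXn) expr1.
  by rewrite !(hornerD, hornerZ, hornerC, hornerX, hornerMn); field.
have -> : discCofactor (4 * s) (6 * s ^+ 2 + a) (4 * s ^+ 3 + 2 * a * s + b)
    (s ^+ 4 + a * s ^+ 2 + b * s + c) = - 2 ^+ 2 * g.[s] ^+ 3 * (g1 ^+ 2 - 4 * g0).
  by rewrite Dgs /discCofactor Ec Eb Dg1 Dg0; ring.
by rewrite !mulf_neq0 ?oppr_eq0 ?expf_neq0.
Qed.

(** Since disc f = f(s) U + f'(s) ^ 2 V with U prime to p, a power of p that
    divides disc f and f'(s) ^ 2 divides f(s). *)
Lemma dvd_taylor_coef0 (p : nat) (a b c s0 s : int) (g : {poly int}) (k : nat) :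
    prime p -> (2 < p)%N ->
    map_poly intr ('X^4 + a *: 'X^2 + b *: 'X + c%:P)
      = ('X - (s0%:~R)%:P) ^+ 2 * map_poly intr g :> {poly 'F_p} ->
    separable_poly (map_poly intr g : {poly 'F_p}) ->
    ~~ (p%:Z %| g.[s0])%Z -> (s = s0 %[mod p%:Z])%Z ->
    (p%:Z ^+ k %| quarticDisc a b c)%Z ->
    (p%:Z ^+ k %| (4 * s ^+ 3 + 2 * a * s + b) ^+ 2)%Z ->
  (p%:Z ^+ k %| s ^+ 4 + a * s ^+ 2 + b * s + c)%Z.
Proof.
move=> p_pr p_gt2 fg sep_g gs0 /eqP; rewrite eqz_mod_dvd => ps dvd_disc dvdD2.
have dvdF m : (p%:Z %| m)%Z = (m%:~R == 0 :> 'F_p).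
  exact: (dvdz_pcharf (pchar_Fp p_pr)).
have nz2 : 2 != 0 :> 'F_p.
  rewrite -(dvdn_pcharf (pchar_Fp p_pr)); apply: contraL p_gt2 => /dvdn_leq.
  by rewrite -leqNgt; apply.
have Ds : s%:~R = s0%:~R :> 'F_p.
  by apply/eqP; rewrite -subr_eq0 -intrB -dvdF.
rewrite map_quartic -Ds in fg; rewrite dvdF -horner_map /= -Ds in gs0.
have := discCofactor_double_root nz2 fg sep_g gs0.
set B := 4 * s; set C := 6 * s ^+ 2 + a; set D := _ + b in dvdD2 *.
set E := _ + c; set U := discCofactor _ _ _ _ => nzU.
have {nzU} pNU : ~~ (p%:Z %| discCofactor B C D E)%Z.
  rewrite dvdF; apply: contraNneq nzU => <-; apply/eqP.
  by rewrite /U /discCofactor /B /C /D /E; ring.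
suffices : (p%:Z ^+ k %| E * discCofactor B C D E)%Z.
  by rewrite Gauss_dvdzl // coprimezXl // coprimezE prime_coprime.
by move: dvd_disc; rewrite (quarticDisc_taylor a b c s) rpredDr // dvdz_mulr.
Qed.

(** * Conjugates of algebraic integers *)

Local Notation QtoC := (map_poly (ratr : rat -> algC)).

Lemma root_irreducible (f q : {poly rat}) (t : algC) :
  irreducible_poly f -> root (QtoC f) t -> root (QtoC q) t = (f %| q).
Proof.
move=> irr_f ft0; apply/idP/idP => [qt0 | /dvdpP[r ->]]; last first.
  by rewrite rmorphM rootM ft0 orbT.
apply: contraLR qt0; rewrite -irreducible_poly_coprime // => co_fq.
by apply: coprimep_root ft0; rewrite coprimep_map.
Qed.

(** The minimal polynomial m of q(t) has integer coefficients, and f divides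
    m \Po q because they share the root t; hence m also annihilates q(t'). *)
Lemma Aint_conjugate (f q : {poly rat}) (t t' : algC) :
    irreducible_poly f -> root (QtoC f) t -> root (QtoC f) t' ->
  (QtoC q).[t] \in Aint -> (QtoC q).[t'] \in Aint.
Proof.
move=> irr_f ft0 ft'0; rewrite unfold_in => int_q.
have := root_minCpoly (QtoC q).[t]; have := minCpoly_monic (QtoC q).[t].
have [m [Dm _] _] := minCpolyP (QtoC q).[t]; rewrite {}Dm in int_q * => mon_m m0.
apply: root_monic_Aint int_q => //.
have comp_root z : root (QtoC (m \Po q)) z = root (QtoC m) (QtoC q).[z].
  by rewrite map_comp_poly root_comp.
by move: m0; rewrite -!comp_root (root_irreducible _ irr_f ft0) (root_irreducible _ irr_f ft'0).
Qed.

(** Denominators are inverted by a Bezout relation with f. *)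
Lemma Qadj_poly (f : {poly rat}) (t x : algC) :
    irreducible_poly f -> root (QtoC f) t -> Qadj t x ->
  exists2 q : {poly rat}, (size q < size f)%N & x = (QtoC q).[t].
Proof.
move=> irr_f ft0 [q [r ->]].
suffices [u ->]: exists u, (QtoC q).[t] / (QtoC r).[t] = (QtoC u).[t].
  exists (u %% f); first by rewrite ltn_modp irredp_neq0.
  rewrite {1}(divp_eq u f) rmorphD rmorphM /= hornerD hornerM (rootP ft0).
  by rewrite mulr0 add0r.
have [/rootP-> | rt_neq0] := boolP (root (QtoC r) t).
  by exists 0; rewrite invr0 mulr0 rmorph0 horner0.
have := rt_neq0; rewrite (root_irreducible _ irr_f ft0) -irreducible_poly_coprime //.
case/Bezout_eq1_coprimepP=> -[u v] /= uv1; exists (q * v).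
apply: (canLR (mulfK rt_neq0)); rewrite rmorphM hornerM -mulrA.
have := congr1 (fun w => (QtoC w).[t]) uv1.
rewrite !rmorphD !rmorphM rmorph1 /= hornerD !hornerM hornerC.
by rewrite (rootP ft0) mulr0 add0r => ->; rewrite mulr1.
Qed.

Lemma Aint_det n (M : 'M[algC]_n) :
  (forall i j, M i j \in Aint) -> \det M \in Aint.
Proof.
by move=> intM; apply: rpred_sum => s _; rewrite rpredMsign rpred_prod.
Qed.

(** Multiply E c = v by the adjugate of E. *)
Lemma Aint_Cramer n (E : 'M[algC]_n) (c v : 'cV[algC]_n) :
    (forall i j, E i j \in Aint) -> (forall i, v i 0 \in Aint) -> E *m c = v ->
  forall k, \det E * c k 0 \in Aint.
Proof.
move=> intE intv Ecv k.
have -> : \det E * c k 0 = (\adj E *m v) k 0.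
  by rewrite -Ecv mulmxA mul_adj_mx mul_scalar_mx mxE.
rewrite mxE; apply: rpred_sum => j _; rewrite rpredM // mxE.
by rewrite /cofactor rpredMsign Aint_det // => i l; rewrite !mxE.
Qed.

(** * Localisation at p *)

Lemma Zloc_frac (p : nat) (u v : int) : ~~ (p%:Z %| v)%Z -> Zloc p (u%:~R / v%:~R).
Proof.
move=> pNv; have nz_v : v != 0 by apply: contraNneq pNv => ->; rewrite dvdz0.
apply: contra pNv => p_den; apply: dvdz_trans p_den _.
set r := u%:~R / v%:~R.
have Dr : numq r * v = u * denq r.
  apply: (@intr_inj rat); rewrite !rmorphM /= numqE /r mulrAC divfK //.
  by rewrite intr_eq0.
suffices : (denq r %| numq r * v)%Z.
  by rewrite Gauss_dvdzr // coprimezE coprime_sym coprime_num_den.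
by rewrite Dr dvdz_mull.
Qed.

Lemma Zloc_divz (p : nat) (r : rat) (m : int) :
  prime p -> Zloc p r -> ~~ (p%:Z %| m)%Z -> Zloc p (r / m%:~R).
Proof.
move=> p_pr pr pm; rewrite -[r]divq_num_den -mulrA -invfM -intrM.
apply: Zloc_frac; rewrite dvdzE abszM Euclid_dvdM // negb_or.
by rewrite -!dvdzE pr.
Qed.

(** A factor p in the denominator of c would contribute two to the valuation of
    c ^ 2, which a valuation of d below 2n + 2 does not compensate. *)
Lemma Zloc_of_sqr (p n : nat) (d : int) (c : rat) :
    prime p -> d != 0 -> (logn p `|d| < n.+1.*2)%N ->
    c ^+ 2 * d%:~R / p%:R ^+ n.*2 \is a Num.int ->
  Zloc p c.
Proof.
move=> p_pr nz_d ltn; case/intrP=> N DN; apply/negP=> p_den.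
have nz_p : p%:R != 0 :> rat by rewrite pnatr_eq0 -lt0n prime_gt0.
have eqZ : numq c ^+ 2 * d = N * p%:Z ^+ n.*2 * denq c ^+ 2.
  apply: (@intr_inj rat); rewrite !rmorphM !rmorphXn /= -DN.
  rewrite [in LHS](numqE c) -pmulrn; field.
  exact: expf_neq0.
have p_num : ~~ (p %| `|numq c|)%N.
  apply/negP=> p_num; have := coprime_num_den c; rewrite /coprime => /eqP co1.
  have : (p %| 1)%N by rewrite -co1 dvdn_gcd p_num.
  by rewrite dvdn1 => /eqP p1; rewrite p1 in p_pr.
have nz_num : (0 < `|numq c|)%N by case: `|numq c|%N p_num => //; rewrite dvdn0.
have nz_den : (0 < `|denq c|)%N by rewrite absz_gt0 denq_neq0.
have nz_absd : (0 < `|d|)%N by rewrite absz_gt0.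
have nz_N : (0 < `|N|)%N.
  rewrite absz_gt0; apply: contra_neq (nz_d) => N0; move/eqP: eqZ.
  by rewrite N0 !mul0r mulf_eq0 expf_eq0 /= -absz_eq0 eqn0Ngt nz_num => /eqP.
have := congr1 (fun z => logn p `|z|) eqZ.
rewrite !abszM !abszX !lognM ?muln_gt0 ?expn_gt0 ?nz_N ?nz_num ?nz_den ?nz_absd ?(prime_gt0 p_pr) //.
have -> : logn p `|numq c| = 0%N by rewrite lognE (negPf p_num) !andbF.
rewrite lognX (logn_prime p p_pr) eqxx muln1 !add0n => Ed.
have : (0 < logn p `|denq c|)%N by rewrite logn_gt0 mem_primes p_pr nz_den.
by move: ltn; rewrite Ed doubleS; lia.
Qed.

(** * The basis *)

Definition basis_at (F : fieldType) (s u v q t : F) : seq F :=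
  [:: 1; t; t ^+ 2; (t ^+ 3 + s * t ^+ 2 + u * t + v) / q].

Lemma det_basis (F : fieldType) (s u v q x y z w : F) : q != 0 ->
  \det (\matrix_(i < 4, j < 4)
     (basis_at s u v q [:: x; y; z; w]`_i)`_j)
  = (y - x) * (z - x) * (w - x) * (z - y) * (w - y) * (w - z) / q.
Proof.
move=> nz_q.
have /= := @det_laplace F 4
  (fun i j => Some (basis_at s u v q [:: x; y; z; w]`_i)`_j).
by move=> ->; rewrite /laplace /=; field.
Qed.

(** The combination of the basis elements with coordinates c, collected by powers
    of the variable: relations between coordinates become relations between
    coefficients. *)
Definition basis_poly (s u v q : rat) (c : nat -> rat) : {poly rat} :=
  Poly [:: c 0%N + v * (c 3 / q); c 1%N + u * (c 3 / q); c 2 + s * (c 3 / q);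
           c 3 / q].

Lemma horner_basis_poly (s u v q : rat) (c : nat -> rat) (t : algC) :
  (QtoC (basis_poly s u v q c)).[t]
  = \sum_(i < 4) ratr (c i) * (basis_at (ratr s) (ratr u) (ratr v) (ratr q) t)`_i.
Proof.
rewrite !big_ord_recl big_ord0 map_Poly /= !horner_cons hornerC.
by rewrite !(rmorphD, rmorphM, fmorphV) /=; ring.
Qed.

Lemma basis_poly_eq0 (s u v q : rat) (c : nat -> rat) : q != 0 ->
  basis_poly s u v q c = 0 -> forall i : 'I_4, c i = 0.
Proof.
move=> nzq c0.
have Ec i : _`_i = _`_i := congr1 (coefp i) c0.
move: (Ec 0) (Ec 1) (Ec 2) (Ec 3); rewrite !coef_Poly !coef0 /=.
move=> + + + E3; have c3 : c 3 = 0 by rewrite -[c 3](divfK nzq) E3 mul0r.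
rewrite c3 mul0r !mulr0 !addr0 => E0 E1 E2.
by case=> [[|[|[|[|i]]]]].
Qed.

Lemma basis_poly_surj (s u v q : rat) (r : {poly rat}) :
  q != 0 -> (size r <= 4)%N -> exists c, r = basis_poly s u v q c.
Proof.
move=> nzq sz.
exists (nth 0 [:: r`_0 - v * r`_3; r`_1 - u * r`_3; r`_2 - s * r`_3; q * r`_3]).
apply/polyP=> i; rewrite coef_Poly /=.
have -> : q * r`_3 / q = r`_3 by field.
rewrite !subrK.
by case: i => [|[|[|[|i]]]] //=; rewrite nth_nil nth_default // (leq_trans sz).
Qed.

(** With y = t - s and B, C, D, E the Taylor coefficients of the quartic at s,
    the numerator h = y ^ 3 + B y ^ 2 + C y + D satisfies h y = - E, so that
    h ^ 4 - D h ^ 3 + C E h ^ 2 - B E ^ 2 h + E ^ 3 = 0.  The division by p ^ n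
    leaves integer coefficients in the equation of h / p ^ n. *)
Lemma Aint_generator (a b c s : int) (p n : nat) (t : algC) :
    (0 < p)%N ->
    root (map_poly intr ('X^4 + a *: 'X^2 + b *: 'X + c%:P)) t ->
    (p%:Z ^+ n %| 4 * s ^+ 3 + 2 * a * s + b)%Z ->
    (p%:Z ^+ n.*2 %| s ^+ 4 + a * s ^+ 2 + b * s + c)%Z ->
  (t ^+ 3 + s%:~R * t ^+ 2 + (a + s ^+ 2)%:~R * t
     + (s ^+ 3 + a * s + b)%:~R) / p%:R ^+ n \in Aint.
Proof.
move=> p_gt0 ft0 /dvdzP[d Dd] /dvdzP[e De].
set P : int := p%:Z ^+ n; have DP : p%:Z ^+ n.*2 = P ^+ 2 by rewrite -muln2 exprM.
rewrite DP in De.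
(* The equation of h / p ^ n, with d = D / p ^ n and e = E / p ^ (2n). *)
pose h : {poly int} := Poly [:: e ^+ 3 * P ^+ 2; - (4 * s * e ^+ 2 * P);
  (6 * s ^+ 2 + a) * e; - d; 1].
have Eh : h = [:: e ^+ 3 * P ^+ 2; - (4 * s * e ^+ 2 * P);
   (6 * s ^+ 2 + a) * e; - d; 1] :> seq int by exact: (@PolyK _ 0).
apply: (@root_monic_Aint (map_poly intr h)); last 2 first.
- by apply: monic_map; rewrite monicE /lead_coef Eh.
- by apply/polyOverP=> i; rewrite coef_map /= intr_int.
have nzP : (P%:~R : algC) != 0 by rewrite intr_eq0 expf_neq0 // -lt0n.
have -> : p%:R ^+ n = P%:~R :> algC by rewrite rmorphXn.
have Db : b = d * P - 4 * s ^+ 3 - 2 * a * s by rewrite -Dd; ring.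
have De' : e%:~R = (s%:~R ^+ 4 + a%:~R * s%:~R ^+ 2 + b%:~R * s%:~R + c%:~R)
                 / P%:~R ^+ 2 :> algC.
  apply: (canRL (mulfK (expf_neq0 _ nzP))).
  by rewrite -rmorphXn -rmorphM /= -De !(rmorphD, rmorphXn, rmorphM).
have Dc : c%:~R = - (t ^+ 4 + a%:~R * t ^+ 2 + b%:~R * t).
  move/rootP: ft0; rewrite map_quartic horner_quartic => ft0.
  by rewrite -[LHS]subr0 -ft0 /=; ring.
rewrite /root /h map_Poly /= !horner_cons hornerC.
rewrite !(rmorphN, rmorphD, rmorphXn, rmorphM, rmorph1) /= De' Dc Db.
rewrite !(rmorphN, rmorphD, rmorphXn, rmorphM) /=.
by apply/eqP; field; rewrite -rmorphXn.
Qed.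

(** The discriminant of the family is disc f / p ^ (2n), of valuation at most 1.
    For an algebraic integer x of the field, with coordinates k_i, Cramer's rule
    applied to the conjugates of x shows that k_i ^ 2 disc f / p ^ (2n) is an
    algebraic integer; being rational, it is an integer, and k_i has no p in its
    denominator. *)
Lemma pIntegralBasis_quartic (p n : nat) (a b c s : int) (theta : algC) :
    prime p ->
    irreducible_poly ('X^4 + a *: 'X^2 + b *: 'X + c%:P) ->
    root (map_poly intr ('X^4 + a *: 'X^2 + b *: 'X + c%:P)) theta ->
    (p%:Z ^+ n %| 4 * s ^+ 3 + 2 * a * s + b)%Z ->
    (p%:Z ^+ n.*2 %| s ^+ 4 + a * s ^+ 2 + b * s + c)%Z ->
    quarticDisc a b c != 0 -> (logn p `|quarticDisc a b c| < n.+1.*2)%N ->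
  pIntegralBasis p (Qadj theta)
    [tuple 1; theta; theta ^+ 2;
      (theta ^+ 3 + s%:~R * theta ^+ 2 + (a + s ^+ 2)%:~R * theta
         + (s ^+ 3 + a * s + b)%:~R) / (p%:R : algC) ^+ n].
Proof.
set f := _ + c%:P => p_pr irr_f ft0 dvdD dvdE nz_d lt_d.
have p_gt0 := prime_gt0 p_pr.
pose fQ : {poly rat} := map_poly intr f.
have irr_fQ : irreducible_poly fQ by apply/irreducible_rat_int.
have DfQ : QtoC fQ = map_poly intr f.
  by rewrite -map_poly_comp; apply: eq_map_poly => x /=; rewrite ratr_int.
have sz_fQ : size fQ = 5%N by rewrite size_rat_int_poly polyseq_quartic.
have nz_q : p%:R ^+ n != 0 :> rat by rewrite expf_neq0 // pnatr_eq0 -lt0n.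
have nz_qC : p%:R ^+ n != 0 :> algC by rewrite expf_neq0 // pnatr_eq0 -lt0n.
pose comb := basis_poly s%:~R (a + s ^+ 2)%:~R (s ^+ 3 + a * s + b)%:~R (p%:R ^+ n).
pose B : algC -> seq algC :=
  basis_at s%:~R (a + s ^+ 2)%:~R (s ^+ 3 + a * s + b)%:~R (p%:R ^+ n).
have horner_comb e t : (QtoC (comb e)).[t] = \sum_(i < 4) ratr (e i) * (B t)`_i.
  by rewrite horner_basis_poly rmorphXn /= ratr_nat !ratr_int.
have intB t : root (QtoC fQ) t -> forall i : 'I_4, (B t)`_i \in Aint.
  rewrite DfQ => tr; have int_t : t \in Aint.
    apply: root_monic_Aint tr _ _.
      by apply: monic_map; rewrite monicE /lead_coef polyseq_quartic.
    by apply/polyOverP=> i; rewrite coef_map /= intr_int.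
  case=> [[|[|[|[|i]]]]] //= _; rewrite ?rpredX ?rpred1 //.
  exact: Aint_generator p_gt0 tr dvdD dvdE.
set e := (X in pIntegralBasis _ _ X); have tnth_e i : tnth e i = (B theta)`_i.
  by rewrite (tnth_nth 0).
have {}ft0 : root (QtoC fQ) theta by rewrite DfQ.
split.
- move=> i; rewrite tnth_e; exists (B theta)`_i, 1; split; last by rewrite divr1.
    split; last exact: intB.
    exists (comb (fun k => (k == i)%:R)), 1.
    rewrite rmorph1 hornerC divr1 horner_comb (bigD1 i) //= eqxx rmorph1 mul1r.
    by rewrite big1 ?addr0 // => j /negPf nji; rewrite [_ == _]nji rmorph0 mul0r.
  by rewrite dvdz1 eqn_leq leqNgt prime_gt1.
- move=> x [y [m [[Ky int_y] pNm ->]]].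
  have [q sz_q Dy] := Qadj_poly irr_fQ ft0 Ky.
  have [k Dq] : exists k, q = comb k.
    by apply: basis_poly_surj => //; rewrite -ltnS -sz_fQ.
  exists (fun i => k i / m%:~R); split; last first.
    rewrite Dy Dq horner_comb mulr_suml; apply: eq_bigr => i _.
    by rewrite tnth_e rmorphM fmorphV /= ratr_int mulrAC.
  move=> i; apply: Zloc_divz => //; apply: (Zloc_of_sqr (n := n) p_pr nz_d) => //.
  have [x1 [x2 [x3 [x4 [/allP roots Ddisc]]]]] :=
    quartic_roots (a%:~R : algC) b%:~R c%:~R.
  pose r := [:: x1; x2; x3; x4].
  have root_r (j : 'I_4) : root (QtoC fQ) r`_j.
    by rewrite DfQ map_quartic; apply: roots; apply: mem_nth.
  (* Rows are indexed by the conjugates of theta, columns by the basis. *)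
  pose E := \matrix_(i0 < 4, j < 4) (B r`_i0)`_j.
  pose v := \col_(j < 4) (QtoC q).[r`_j].
  pose kC := \col_(j < 4) (ratr (k j) : algC).
  have int_det : \det E * ratr (k i) \in Aint.
    have -> : ratr (k i) = kC i 0 by rewrite mxE.
    apply: (@Aint_Cramer 4 E kC v) => [i0 j | j |].
    + by rewrite mxE; exact: intB.
    + by rewrite mxE; apply: Aint_conjugate irr_fQ ft0 (root_r j) _; rewrite -Dy.
    apply/colP=> j; rewrite !mxE Dq horner_comb; apply: eq_bigr => l _.
    by rewrite !mxE mulrC.
  rewrite -Cint_rat; apply: Cint_rat_Aint (Crat_rat _) _.
  (* By Vandermonde, \det E ^ 2 is the discriminant divided by p ^ (2n). *)
  have -> : ratr (k i ^+ 2 * (quarticDisc a b c)%:~R / p%:R ^+ n.*2)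
      = (\det E * ratr (k i)) ^+ 2 :> algC.
    have DdC : (quarticDisc a b c)%:~R = quarticDisc a%:~R b%:~R c%:~R :> algC.
      by rewrite /quarticDisc; ring.
    rewrite det_basis // exprMn expr_div_n -Ddisc -exprM muln2 -DdC.
    by rewrite fmorph_div rmorphM !rmorphXn /= ratr_nat ratr_int [RHS]mulrC mulrA.
  by rewrite rpredX.
move=> k int_k k0.
pose k' l := k (inord l); have Ek (i : 'I_4) : k' i = k i by rewrite /k' inord_val.
have comb0 : comb k' = 0.
  have k'0 : root (QtoC (comb k')) theta.
    apply/rootP; rewrite horner_comb; apply: etrans k0; apply: eq_bigr => i _.
    by rewrite Ek tnth_e.
  apply/eqP; apply: contraTT k'0 => nz_comb; rewrite (root_irreducible _ irr_fQ ft0).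
  apply: contraL (size_Poly _ : size (comb k') <= 4)%N => /(dvdp_leq nz_comb).
  by rewrite sz_fQ -ltnNge.
by move=> i; rewrite -Ek (basis_poly_eq0 nz_q comb0).
Qed.

Theorem mainTheorem5 (p : nat) (hp : prime p) (hp2 : (2 < p)%N)
    (a b c : int) (f : {poly int})
    (hf : f = 'X^4 + a *: 'X^2 + b *: 'X + c%:P)
    (hirr : irreducible_poly f)
    (theta : algC) (htheta : root (map_poly intr f) theta)
    (s0 : int) (g : {poly int})
    (hfg : map_poly intr f
           = ('X - (s0%:~R)%:P) ^+ 2 * map_poly intr g :> {poly 'F_p})
    (hgsep : separable_poly (map_poly intr g : {poly 'F_p}))
    (hgs0 : ~~ (p%:Z %| g.[s0])%Z)
    (Delta : rat) (hDelta : Delta = fine (vp p (disc f)))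
    (s : int) (hs : (s = s0 %[mod p%:Z])%Z)
    (hfs : (vp p (f^`()).[s] > (Delta / 2)%:E)%E)
    (nu : int) (hnu : nu = Num.floor (Delta / 2)) :
  pIntegralBasis p (Qadj theta)
    [tuple 1; theta; theta ^+ 2;
      (theta ^+ 3 + s%:~R * theta ^+ 2 + (a + s ^+ 2)%:~R * theta
         + (s ^+ 3 + a * s + b)%:~R) / (p%:R : algC) ^ nu].
Proof.
subst f; set f := _ + c%:P in hirr htheta hDelta hfs hfg *.
have polyseq_f : f = [:: c; b; a; 0; 1] :> seq int by exact: polyseq_quartic.
have Ddisc : disc f = quarticDisc a b c.
  rewrite /disc polyseq_f /lead_coef polyseq_f /= divz1 resultant_quartic.
  by rewrite -signr_odd /= mul1r.
have nz_disc : quarticDisc a b c != 0.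
  rewrite -resultant_quartic resultant_eq0 -/f -leqNgt.
  have : coprimep f f^`().
    rewrite irreducible_poly_coprime //; apply/negP=> f_dvd.
    have nz_f' : f^`() != 0.
      apply/eqP=> /(congr1 (coefp 3)) /eqP.
      by rewrite /= coef_deriv polyseq_f coef0.
    have := Pdiv.Idomain.dvdp_leq nz_f' f_dvd.
    by rewrite leqNgt lt_size_deriv // -size_poly_gt0 polyseq_f.
  by rewrite coprimep_def => /eqP->.
set k := logn p `|quarticDisc a b c|.
have {hDelta} DDelta : Delta = k%:R by rewrite hDelta /vp Ddisc (negPf nz_disc).
have {hnu} Dnu : nu = k./2%:Z.
  rewrite hnu DDelta; apply: floor_def; apply/andP; split.
    by rewrite ler_pdivlMr // -pmulrn -natrM ler_nat; lia.
  by rewrite ltr_pdivrMr // -PoszD -pmulrn -natrM ltr_nat; lia.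
have Df' : f^`().[s] = 4 * s ^+ 3 + 2 * a * s + b.
  rewrite !(derivD, derivZ, derivC, derivX, derivXn).
  by rewrite !(hornerD, hornerZ, hornerC, hornerMn, hornerXn) /= expr1; ring.
rewrite Df' DDelta in hfs; set D := _ + b in Df' hfs.
have pk_disc : (p%:Z ^+ k %| quarticDisc a b c)%Z.
  by rewrite dvdzE abszX pfactor_dvdn // absz_gt0.
(* When f'(s) = 0 its valuation is infinite, and any large exponent will do. *)
have [l le_kl pl_D] : exists2 l, (k < l.*2)%N & (p%:Z ^+ l %| D)%Z.
  move: hfs; rewrite /vp; have [-> _ | nzD] := eqVneq D 0.
    by exists k.+1; rewrite ?dvdz0 // -addnn leq_addr.
  rewrite lte_fin ltr_pdivrMr // -natrM ltr_nat muln2 => lt_k.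
  by exists (logn p `|D|) => //; rewrite dvdzE abszX pfactor_dvdn // absz_gt0.
have pk_D2 : (p%:Z ^+ k %| D ^+ 2)%Z.
  apply: dvdz_trans (dvdz_exp2r 2 pl_D); rewrite -exprM muln2.
  by apply: dvdz_exp2l; apply: ltnW.
rewrite Dnu; apply: (pIntegralBasis_quartic hp hirr htheta) => //.
- apply: dvdz_trans pl_D; apply: dvdz_exp2l.
  by rewrite -leq_double; apply: leq_trans (ltnW le_kl); rewrite -{2}(odd_double_half k) leq_addl.
- apply: dvdz_trans (dvdz_exp2l _ _) (dvd_taylor_coef0 hp hp2 hfg hgsep hgs0 hs pk_disc pk_D2).
  by rewrite -{2}(odd_double_half k) leq_addl.
- rewrite -/k doubleS -{1}(odd_double_half k) ltnS -add1n leq_add2r.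
  by case: (odd k).
Qed.
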